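(* Let $G_1,G_2,G_k$ be generators over $\Sigma_1,\Sigma_2,\Sigma_k$, respectively, such that $G_1$ and $G_2$ are conditionally independent with respect to $G_k$. Let $K\subseteq L_m(G_1\|G_2\|G_k)$ be a language such that $K$ and $\overline{K}$ are conditionally decomposable with respect to $\Sigma_1,\Sigma_2,\Sigma_k$. Let $L=L(G_1\|G_2\|G_k)$ and define $$\mathrm{supC}_k=\mathrm{supC}(P_k(K),L(G_k),\Sigma_{k,u}),\qquad \mathrm{supC}_{i+k}=\mathrm{supC}(P_{i+k}(K),L(G_i)\|\overline{\mathrm{supC}_k},\Sigma_{i+k,u}),\quad i=1,2.$$ If $\mathrm{supC}_k\subseteq P_k(\mathrm{supC}_{i+k})$ for $i=1,2$, then $$\mathrm{supC}_{1+k}\,\|\,\mathrm{supC}_{2+k}=\mathrm{supcC}(K,L,(\Sigma_{1,u},\Sigma_{2,u},\Sigma_{k,u})),$$ the supremal conditionally controllable sublanguage of $K$.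
   Context: A generator $G=(Q,\Sigma,f,q_0,Q_m)$ is a deterministic finite automaton with partial transition function; $L(G)$ is the set of words $s$ with $f(q_0,s)$ defined and $L_m(G)$ those with $f(q_0,s)\in Q_m$. Languages given as data are regular. $\overline{M}$ is the prefix closure of $M$. Let $\Sigma=\Sigma_1\cup\Sigma_2$, with $\Sigma_u\subseteq\Sigma$ the uncontrollable events, $\Sigma_{j,u}=\Sigma_j\cap\Sigma_u$ for $j=1,2,k$, and $\Sigma_{i+k,u}=(\Sigma_i\cup\Sigma_k)\cap\Sigma_u$. Projections erase events outside the target event set: $P_k$ maps to $\Sigma_k^*$ (also when applied to words over a subset of $\Sigma$), and $P_{i+k}:\Sigma^*\to(\Sigma_i\cup\Sigma_k)^*$. The synchronous product of languages $L_i$ over $A_i$ is the set of words over $\bigcup_iA_i$ whose projection to $A_i^*$ is in $L_i$ for every $i$; $L(G\|G')=L(G)\|L(G')$ and $L_m(G\|G')=L_m(G)\|L_m(G')$. Conditional independence of $G_1,G_2$ with respect to $G_k$: $\Sigma_r(G_1)\cap\Sigma_r(G_2)\subseteq\Sigma_r(G_k)$, where $\Sigma_r(G)$ is the set of events occurring in words of $L(G)$. A language $M\subseteq\Sigma^*$ is conditionally decomposable with respect to $\Sigma_1,\Sigma_2,\Sigma_k$, where $\Sigma_1\cap\Sigma_2\subseteq\Sigma_k\subseteq\Sigma_1\cup\Sigma_2$, if $M=P_{1+k}(M)\|P_{2+k}(M)$. $M$ is controllable with respect to a prefix-closed language $N$ and event set $U$ if $\overline{M}U\cap N\subseteq\overline{M}$.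 $\mathrm{supC}(M,N,U)$ is the supremal controllable sublanguage: the union of all languages $M'\subseteq M\cap N$ controllable with respect to $N$ and $U$. A language $M\subseteq L(G_1\|G_2\|G_k)$ is conditionally controllable for $G_1,G_2,G_k$ and $\Sigma_{1,u},\Sigma_{2,u},\Sigma_{k,u}$ if $P_k(M)$ is controllable with respect to $L(G_k)$ and $\Sigma_{k,u}$, and for $i=1,2$, $P_{i+k}(M)$ is controllable with respect to $L(G_i)\|\overline{P_k(M)}$ and $\Sigma_{i+k,u}$. $\mathrm{supcC}(K,L,(\Sigma_{1,u},\Sigma_{2,u},\Sigma_{k,u}))$ is the largest conditionally controllable sublanguage of $K$, equal to the union of all conditionally controllable sublanguages of $K$. *)

(* Defs.v *)
(* MathComp with mathcomp-classical.  Every alphabet is a subset [A : {set E}]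
   of one ambient finite type [E] of events, and a language is a [set (seq E)];
   the synchronous product therefore takes the alphabets of its two factors
   explicitly. *)
From mathcomp Require Import all_boot.
From mathcomp Require Import boolp classical_sets.

Set Implicit Arguments.
Unset Strict Implicit.
Unset Printing Implicit Defensive.

Local Open Scope classical_set_scope.

Section Languages.
Variable E : finType.
Implicit Types (A B U : {set E}) (M N : set (seq E)).

Definition words A : set (seq E) := [set w | all (mem A) w].

Definition proj A (w : seq E) : seq E := [seq a <- w | a \in A].

Definition prefix_closure M : set (seq E) := [set u | exists v, M (u ++ v)].

Definition lang_sync A B M N : set (seq E) :=
  [set w | [/\ words (A :|: B) w, M (proj A w) & N (proj B w)]].

(* [controllable M N U] is only meant for prefix-closed [N]. *)
Definition controllable M N U : Prop :=
  [set rcons s a | s in prefix_closure M & a in [set` U]] `&` N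
    `<=` prefix_closure M.

Definition supC M N U : set (seq E) :=
  \bigcup_(M' in [set M' | M' `<=` M `&` N /\ controllable M' N U]) M'.

Definition cond_decomposable (S1 S2 Sk : {set E}) M : Prop :=
  M = lang_sync (S1 :|: Sk) (S2 :|: Sk)
        (proj (S1 :|: Sk) @` M) (proj (S2 :|: Sk) @` M).

Record generator A := Generator {
  state : finType;
  trans : state -> E -> option state;
  trans_alphabet : forall q a, a \notin A -> trans q a = None;
  init : state;
  marked : {set state}
}.

Fixpoint run A (G : generator A) (q : state G) (w : seq E) : option (state G) :=
  if w is a :: w' then obind (fun q' => run q' w') (trans q a) else Some q.

Definition gen_lang A (G : generator A) : set (seq E) :=
  [set w | run (init G) w].

Lemma gen_lang_prefix A (G : generator A) (u v : seq E) :
  gen_lang G (u ++ v) -> gen_lang G u.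
Proof.
rewrite /gen_lang /=; elim: u (init G) => [|a u IH] q //=.
by case: (trans q a) => //= q'; exact: IH.
Qed.

Definition marked_lang A (G : generator A) : set (seq E) :=
  [set w | exists2 q, run (init G) w = Some q & q \in marked G].

Definition regular A M : Prop := exists G : generator A, M = marked_lang G.

(* A component does not move on an event outside its own alphabet. *)
Definition local_step A (G : generator A) (q : state G) (a : E) :
    option (state G) :=
  if a \in A then trans q a else Some q.

Definition sync_trans A B (G : generator A) (H : generator B)
    (q : state G * state H) (a : E) : option (state G * state H) :=
  if a \in A :|: B then
    if (local_step q.1 a, local_step q.2 a) is (Some q1, Some q2)
    then Some (q1, q2) else None
  else None.

Fact sync_trans_alphabet A B (G : generator A) (H : generator B)
    (q : state G * state H) (a : E) :
  a \notin A :|: B -> sync_trans q a = None.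
Proof. by rewrite /sync_trans => /negbTE ->. Qed.

Definition gen_sync A B (G : generator A) (H : generator B) :
    generator (A :|: B) :=
  {| state := (state G * state H)%type;
     trans := @sync_trans A B G H;
     trans_alphabet := @sync_trans_alphabet A B G H;
     init := (init G, init H);
     marked := finset.setX (marked G) (marked H) |}.

Lemma run_gen_sync A B (G : generator A) (H : generator B)
    (q : state (gen_sync G H)) (w : seq E) :
  run q w =
    if all (mem (A :|: B)) w then
      if (run q.1 (proj A w), run q.2 (proj B w)) is (Some q1, Some q2)
      then Some (q1, q2) else None
    else None.
Proof.
elim: w q => [|a w IH] [q1 q2] //=.
rewrite /sync_trans /local_step /=.
case: ifPn => //= aAB; rewrite inE in aAB.
case: (boolP (a \in A)) aAB => aA; case: (boolP (a \in B)) => aB //= _.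
- case: (trans q1 a) => [r1|] /=; last by case: ifP.
  by case: (trans q2 a) => [r2|] /=; rewrite ?IH //; case: ifP => // _; case: run.
- by case: (trans q1 a) => [r1|] /=; rewrite ?IH //; case: ifP.
- by case: (trans q2 a) => [r2|] /=; rewrite ?IH //; case: ifP => // _; case: run.
Qed.

Lemma gen_lang_sync A B (G : generator A) (H : generator B) :
  gen_lang (gen_sync G H) = lang_sync A B (gen_lang G) (gen_lang H).
Proof.
apply/seteqP; split=> w; rewrite /gen_lang /lang_sync /words /= run_gen_sync /=.
  by case: ifP => // _; case: run => // ?; case: run.
by move=> [-> ]; case: run => // ? _; case: run.
Qed.

Lemma marked_lang_sync A B (G : generator A) (H : generator B) :
  marked_lang (gen_sync G H) = lang_sync A B (marked_lang G) (marked_lang H).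
Proof.
apply/seteqP; split=> w; rewrite /marked_lang /lang_sync /words /= run_gen_sync /=.
  case=> -[q1 q2]; case: ifP => // _; case: run => // r1; case: run => // r2.
  by move=> [<- <-]; rewrite finset.in_setX => /andP[m1 m2]; split=> //; [exists r1|exists r2].
by move=> [-> [r1 -> m1] [r2 -> m2]]; exists (r1, r2); rewrite // finset.in_setX m1.
Qed.

Definition reachable_events A (G : generator A) : set E :=
  [set a | exists2 w, gen_lang G w & a \in w].

Definition cond_independent A B C
    (G1 : generator A) (G2 : generator B) (Gk : generator C) : Prop :=
  reachable_events G1 `&` reachable_events G2 `<=` reachable_events Gk.

Section ConditionalControllability.
Variables (S1 S2 Sk Su : {set E}).
Variables (G1 : generator S1) (G2 : generator S2) (Gk : generator Sk).

(* [Su] is the set of all uncontrollable events. *)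
Definition cond_controllable M : Prop :=
  [/\ M `<=` gen_lang (gen_sync (gen_sync G1 G2) Gk),
      controllable (proj Sk @` M) (gen_lang Gk) (Sk :&: Su),
      controllable (proj (S1 :|: Sk) @` M)
        (lang_sync S1 Sk (gen_lang G1) (prefix_closure (proj Sk @` M)))
        ((S1 :|: Sk) :&: Su)
    & controllable (proj (S2 :|: Sk) @` M)
        (lang_sync S2 Sk (gen_lang G2) (prefix_closure (proj Sk @` M)))
        ((S2 :|: Sk) :&: Su)].

Definition supcC K : set (seq E) :=
  \bigcup_(M in [set M | M `<=` K /\ cond_controllable M]) M.

Lemma supcC_max K M : M `<=` K -> cond_controllable M -> M `<=` supcC K.
Proof. by move=> MK cM w Mw; exists M. Qed.

Lemma supcC_sub K : supcC K `<=` K.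
Proof. by move=> w [M [MK _] Mw]; exact: MK. Qed.

Lemma supcC_cond_controllable K : cond_controllable (supcC K).
Proof.
set M := supcC K.
have clS N A : N `<=` M ->
    prefix_closure (proj A @` N) `<=` prefix_closure (proj A @` M).
  by move=> NM u [v [w Nw e]]; exists v; exists w => //; exact: NM.
have ML : M `<=` gen_lang (gen_sync (gen_sync G1 G2) Gk).
  by move=> w [N [_ [NL _ _ _]] Nw]; exact: NL.
have MLk : prefix_closure (proj Sk @` M) `<=` gen_lang Gk.
  move=> u [v [w /ML]]; rewrite gen_lang_sync => -[_ _ wk] e.
  by apply: (@gen_lang_prefix _ _ _ v); rewrite -e.
have ctrl S (G : generator S) (hM : forall N, N `<=` K -> cond_controllable N ->
      controllable (proj (S :|: Sk) @` N)
        (lang_sync S Sk (gen_lang G) (prefix_closure (proj Sk @` N)))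
        ((S :|: Sk) :&: Su)) :
    controllable (proj (S :|: Sk) @` M)
      (lang_sync S Sk (gen_lang G) (prefix_closure (proj Sk @` M)))
      ((S :|: Sk) :&: Su).
  move=> _ [[s [v [w [N [NK cN] Nw] e]] [a aU <-]]] [wsa sa_i sa_k].
  have NM := supcC_max NK cN; apply: (clS N _ NM); apply: (hM N NK cN).
  split; first by exists s; [exists v; exists w | exists a].
  split=> //; have [_ ck _ _] := cN.
  have sN : prefix_closure (proj Sk @` N) (proj Sk s).
    exists (proj Sk v); exists w => //.
    rewrite /proj -filter_cat -e /proj -filter_predI; apply: eq_filter => x /=.
    by rewrite !inE; case: (x \in Sk); rewrite ?orbT.
  have aSu : a \in Su by move: aU; rewrite /= inE => /andP[].
  move: (sa_k); rewrite /proj filter_rcons; case: ifP => // aSk saM.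
  apply: ck; split; last exact: MLk.
  by exists (proj Sk s) => //; exists a => //=; rewrite inE aSk.
split=> //; last 2 first.
- by apply: ctrl => N _ [].
- by apply: ctrl => N _ [].
move=> _ [[s [v [w [N [NK cN] Nw] e]] [a aU <-]]] sa.
have NM := supcC_max NK cN; apply: (clS N _ NM); have [_ ck _ _] := cN.
by apply: ck; split=> //; exists s; [exists v; exists w | exists a].
Qed.

End ConditionalControllability.
End Languages.

(* Main.v *)
(* A gluing lemma shows that two words with the same projection to [Sk] are the
   projections of a common word.  With it, the two inclusion hypotheses give
   [P_k (supC_1k || supC_2k) = supC_k] and
   [P_{i+k} (supC_1k || supC_2k) = supC_{i+k}], so that conditional
   controllability of the product is the controllability of the three supC
   languages.  Conversely, the projections of any conditionally controllable
   sublanguage of [K] are among the languages whose unions define the supC's. *)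
Require Import Defs.
From mathcomp Require Import all_boot.
From mathcomp Require Import boolp classical_sets.

Set Implicit Arguments.
Unset Strict Implicit.
Unset Printing Implicit Defensive.

Local Open Scope classical_set_scope.

Section Projections.
Variable E : finType.
Implicit Types (A B U : {set E}) (M N : set (seq E)).

Lemma proj_proj A B (w : seq E) : proj A (proj B w) = proj (A :&: B) w.
Proof. by rewrite /proj -filter_predI; apply: eq_filter => x; rewrite /= inE. Qed.

Lemma proj_proj_sub A B (w : seq E) :
  A \subset B -> proj A (proj B w) = proj A w.
Proof. by move=> /finset.setIidPl AB; rewrite proj_proj AB. Qed.

Lemma proj_words A (w : seq E) : words A w -> proj A w = w.
Proof. by move=> /all_filterP. Qed.

(** The two words are interleaved from the left: a private letter at the head of either word is
    emitted alone, and a shared letter is emitted once, when it heads both words. Equality of the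
    shared projections rules out a deadlock. *)
Lemma sync_merge A B (u v : seq E) :
  words A u -> words B v -> proj (A :&: B) u = proj (A :&: B) v ->
  exists w, [/\ words (A :|: B) w, proj A w = u & proj B w = v].
Proof.
rewrite /words /=; elim: u v => [|a u IHu] v.
  move=> _ vB /esym vnil; exists v; split; last exact: proj_words.
    by apply: sub_all vB => x /=; rewrite inE => ->; rewrite orbT.
  (* Since [v] is over [B], its projection to [A] is its projection to the shared alphabet, which is
     empty here. *)
  by rewrite -[in LHS](proj_words vB) proj_proj vnil.
move=> /= /andP[aA uA]; rewrite finset.in_setI aA /=.
case: (boolP (a \in B)) => aB; last first.
  move=> vB /(IHu _ uA vB) [w [wAB wu wv]]; exists (a :: w).
  by rewrite /= finset.in_setU aA (negbTE aB) wu.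
elim: v => [|b v IHv] //= /andP[bB vB]; rewrite finset.in_setI bB andbT.
case: (boolP (b \in A)) => bA.
  case=> <- /(IHu _ uA vB) [w [wAB wu wv]]; exists (a :: w).
  by rewrite /= finset.in_setU aA aB wu wv.
move=> /(IHv vB) [w [wAB wu wv]]; exists (b :: w).
by rewrite /= finset.in_setU bB (negbTE bA) orbT wv.
Qed.

Lemma proj_sync_l A B M N (w : seq E) :
  M `<=` words A -> N `<=` words B ->
  M w -> (proj (A :&: B) @` N) (proj (A :&: B) w) ->
  (proj A @` lang_sync A B M N) w.
Proof.
move=> MA NB Mw [v Nv /esym e].
have [x [xAB xw xv]] := sync_merge (MA _ Mw) (NB _ Nv) e.
by exists x => //; split; rewrite ?xw ?xv.
Qed.

Lemma lang_syncC A B M N : lang_sync A B M N = lang_sync B A N M.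
Proof. by apply/seteqP; split=> w [wAB ? ?]; split; rewrite // finset.setUC. Qed.

Lemma sub_prefix_closure M : M `<=` prefix_closure M.
Proof. by move=> w Mw; exists [::]; rewrite cats0. Qed.

Lemma prefix_closureS M N : M `<=` N -> prefix_closure M `<=` prefix_closure N.
Proof. by move=> MN u [v /MN]; exists v. Qed.

Lemma prefix_closureK M : prefix_closure (prefix_closure M) = prefix_closure M.
Proof.
apply/seteqP; split; last exact: sub_prefix_closure.
by move=> u [v [w]]; rewrite -catA; exists (v ++ w).
Qed.

Lemma prefix_closure_proj A M (s : seq E) :
  prefix_closure M s -> prefix_closure (proj A @` M) (proj A s).
Proof. by move=> [v Mv]; exists (proj A v), (s ++ v); rewrite // /proj filter_cat. Qed.

Lemma image_proj_proj A B M :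
  A \subset B -> proj A @` (proj B @` M) = proj A @` M.
Proof.
by move=> AB; rewrite image_comp; apply: eq_imagel => w _ /=; rewrite proj_proj_sub.
Qed.

Lemma supC_sub M N U : supC M N U `<=` M.
Proof. by move=> w [M' [M'sub _] /M'sub[]]. Qed.

Lemma supC_subr M N U : supC M N U `<=` N.
Proof. by move=> w [M' [M'sub _] /M'sub[]]. Qed.

Lemma supC_max M N U M' :
  M' `<=` M -> M' `<=` N -> controllable M' N U -> M' `<=` supC M N U.
Proof. by move=> sM sN c w w'; exists M' => //; split=> // x M'x; split; auto. Qed.

(** Controllability survives unions: a prefix of a word of the union is already a prefix of a word
    of one controllable member. *)
Lemma supC_controllable M N U : controllable (supC M N U) N U.
Proof.
move=> _ [[s [v [M' [sub c] M'sv]] [a aU <-]] saN].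
have /prefix_closureS : M' `<=` supC M N U by move=> w; exists M'.
by apply; apply: c; split=> //; exists s; [exists v | exists a].
Qed.

(* The candidate [prefix_closure (supC M N U) `&` M] has the same prefix closure
   as [supC M N U], hence is controllable. *)
Lemma supC_relatively_closed M N U :
  prefix_closure N `<=` N ->
  prefix_closure (supC M N U) `&` M `<=` supC M N U.
Proof.
move=> Ncl; set C := supC M N U; set D := _ `&` M.
have eCD : prefix_closure D = prefix_closure C.
  apply/seteqP; split.
    by rewrite -[X in _ `<=` X]prefix_closureK; apply: prefix_closureS => w [].
  apply: prefix_closureS => w Cw; split; last exact: supC_sub Cw.
  exact: sub_prefix_closure.
apply: supC_max => [w []//|w [Cw _]|].
  by apply: Ncl; apply: prefix_closureS Cw; exact: supC_subr.
by rewrite /controllable eCD; exact: supC_controllable.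
Qed.

Lemma gen_lang_closed A (G : generator A) :
  prefix_closure (gen_lang G) `<=` gen_lang G.
Proof. by move=> u [v]; exact: gen_lang_prefix. Qed.

Lemma marked_lang_sub A (G : generator A) : marked_lang G `<=` gen_lang G.
Proof. by move=> w [q e _]; rewrite /gen_lang /= e. Qed.

Lemma proj_supC_sub S Sk (Uk U : {set E}) (G : generator S) (Gk : generator Sk)
    (K : set (seq E)) :
  let C := supC (proj Sk @` K) (gen_lang Gk) Uk in
  proj Sk @` supC (proj (S :|: Sk) @` K)
    (lang_sync S Sk (gen_lang G) (prefix_closure C)) U `<=` C.
Proof.
move=> C _ [w Mw <-]; apply: supC_relatively_closed; first exact: gen_lang_closed.
split; first by have [] := supC_subr Mw.
by have [x Kx <-] := supC_sub Mw; exists x; rewrite // proj_proj_sub ?finset.subsetUr.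
Qed.

Lemma proj_sub_supC S Sk Su (G : generator S) (Gk : generator Sk)
    (K M : set (seq E)) :
  let C := supC (proj Sk @` K) (gen_lang Gk) (Sk :&: Su) in
  M `<=` K -> proj S @` M `<=` gen_lang G -> proj Sk @` M `<=` gen_lang Gk ->
  controllable (proj Sk @` M) (gen_lang Gk) (Sk :&: Su) ->
  controllable (proj (S :|: Sk) @` M)
    (lang_sync S Sk (gen_lang G) (prefix_closure (proj Sk @` M)))
    ((S :|: Sk) :&: Su) ->
  proj (S :|: Sk) @` M `<=`
    supC (proj (S :|: Sk) @` K)
      (lang_sync S Sk (gen_lang G) (prefix_closure C)) ((S :|: Sk) :&: Su).
Proof.
move=> C MK MG MGk ck ci.
have MC : proj Sk @` M `<=` C by apply: supC_max => //; exact: image_subset.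
apply: supC_max; first exact: image_subset.
  move=> _ [w Mw <-]; split; first exact: filter_all.
    by rewrite proj_proj_sub ?finset.subsetUl //; apply: MG; exists w.
  rewrite proj_proj_sub ?finset.subsetUr //.
  by apply: sub_prefix_closure; apply: MC; exists w.
move=> _ [[s sM [a aU <-]]] [wsa saG saC].
apply: ci; split; first by exists s => //; exists a.
split=> //; have := prefix_closure_proj Sk sM.
rewrite image_proj_proj ?finset.subsetUr // => skM.
(* An event outside [Sk] leaves the projection of [s] unchanged; only an event of [Sk] needs
   [ck]. *)
move: saC; rewrite /proj filter_rcons; case: ifP => // aSk saC.
apply: ck; split.
  exists (proj Sk s) => //; exists a => //=.
  by move: aU; rewrite /= !inE aSk => /andP[].
apply: gen_lang_closed; apply: prefix_closureS saC; exact: supC_subr.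
Qed.

End Projections.

Theorem theorem6 (E : finType) (S1 S2 Sk Su : {set E})
    (G1 : generator S1) (G2 : generator S2) (Gk : generator Sk)
    (K : set (seq E))
    (hSk_ge : S1 :&: S2 \subset Sk) (hSk_le : Sk \subset S1 :|: S2)
    (hSu : Su \subset S1 :|: S2)
    (hind : cond_independent G1 G2 Gk)
    (hKreg : regular (S1 :|: S2) K)
    (hK : K `<=` marked_lang (gen_sync (gen_sync G1 G2) Gk))
    (hKdec : cond_decomposable S1 S2 Sk K)
    (hKcldec : cond_decomposable S1 S2 Sk (prefix_closure K)) :
  let supCk := supC (proj Sk @` K) (gen_lang Gk) (Sk :&: Su) in
  let supC1k := supC (proj (S1 :|: Sk) @` K)
      (lang_sync S1 Sk (gen_lang G1) (prefix_closure supCk))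
      ((S1 :|: Sk) :&: Su) in
  let supC2k := supC (proj (S2 :|: Sk) @` K)
      (lang_sync S2 Sk (gen_lang G2) (prefix_closure supCk))
      ((S2 :|: Sk) :&: Su) in
  supCk `<=` proj Sk @` supC1k ->
  supCk `<=` proj Sk @` supC2k ->
  lang_sync (S1 :|: Sk) (S2 :|: Sk) supC1k supC2k = supcC Su G1 G2 Gk K.
Proof.
move=> supCk supC1k supC2k h1 h2.
have SkE : (S1 :|: Sk) :&: (S2 :|: Sk) = Sk.
  by rewrite -finset.setUIl; apply/finset.setUidPr.
have SE : (S1 :|: Sk) :|: (S2 :|: Sk) = S1 :|: S2.
  by rewrite finset.setUACA finset.setUid; apply/finset.setUidPl.
have KL : K `<=` gen_lang (gen_sync (gen_sync G1 G2) Gk).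
  by move=> w /hK; exact: marked_lang_sub.
have sub1 : proj Sk @` supC1k `<=` supCk by exact: proj_supC_sub.
have sub2 : proj Sk @` supC2k `<=` supCk by exact: proj_supC_sub.
have w1 : supC1k `<=` words (S1 :|: Sk) by move=> w /supC_subr[].
have w2 : supC2k `<=` words (S2 :|: Sk) by move=> w /supC_subr[].
set M := lang_sync _ _ _ _.
have p1 : proj (S1 :|: Sk) @` M = supC1k.
  apply/seteqP; split=> [_ [w [_ ? _] <-] //|w Mw].
  (* The hypotheses cross over: the partner of a word of [supC1k] must be found in [supC2k], so [h2]
     serves here and [h1] in the symmetric case. *)
  by apply: proj_sync_l => //; rewrite SkE; apply: h2; apply: sub1; exists w.
have p2 : proj (S2 :|: Sk) @` M = supC2k.
  apply/seteqP; split=> [_ [w [_ _ ?] <-] //|w Mw].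
  rewrite /M lang_syncC; apply: proj_sync_l => //.
  by rewrite finset.setIC SkE; apply: h1; apply: sub2; exists w.
have pk : proj Sk @` M = supCk.
  (* Projecting through [S1 :|: Sk] reduces the claim to [sub1] and [h1]. *)
  rewrite -(image_proj_proj _ (finset.subsetUr S1 Sk)) p1.
  by apply/seteqP; split.
have MK : M `<=` K.
  by move=> w [wS /supC_sub ? /supC_sub ?]; rewrite hKdec.
apply/seteqP; split.
  apply: supcC_max => //; split; first exact: subset_trans KL.
  - rewrite pk; exact: supC_controllable.
  - rewrite p1 pk; exact: supC_controllable.
  - rewrite p2 pk; exact: supC_controllable.
move=> w [N [NK [NL ck c1 c2]] Nw].
have NG x : N x -> [/\ words (S1 :|: S2) x, gen_lang G1 (proj S1 x),
    gen_lang G2 (proj S2 x) & gen_lang Gk (proj Sk x)].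
  move=> /NL; rewrite !gen_lang_sync => -[xS [_]].
  rewrite !proj_proj_sub ?finset.subsetUl ?finset.subsetUr // => ? ? ?.
  (* The alphabet of the triple product is [(S1 :|: S2) :|: Sk], which collapses by [hSk_le]. *)
  by split=> //; rewrite -(finset.setUidPl hSk_le).
have NGk : proj Sk @` N `<=` gen_lang Gk by move=> _ [x /NG[_ _ _ xk] <-].
split; first by rewrite SE; have [] := NG _ Nw.
- apply: (proj_sub_supC NK _ NGk ck c1); last by exists w.
  by move=> _ [x /NG[_ x1 _ _] <-].
- apply: (proj_sub_supC NK _ NGk ck c2); last by exists w.
  by move=> _ [x /NG[_ _ x2 _] <-].
Qed.
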